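(* For each of the following pairs $(p,p')$ of patterns, the class of $p$-representable graphs equals the class of $p'$-representable graphs: $(112,122)$; $(121,212)$; $(211,221)$; $(132,213)$; $(231,312)$.
   Context: All graphs are finite, simple and undirected. Let $[n]=\{1,\ldots,n\}$. For a word $w$ over positive integers, $\mathrm{red}(w)$ is the word obtained from $w$ by replacing each occurrence of the $i$th smallest letter with $i$. For a word (pattern) $p=p_1\cdots p_k$ with $\mathrm{red}(p)=p$, a word $w=w_1\cdots w_\ell$ contains $p$ if there are indices $i_1<\cdots<i_k$ with $\mathrm{red}(w_{i_1}\cdots w_{i_k})=p$; otherwise $w$ avoids $p$ (is $p$-avoiding). A labeled graph with vertex set $[n]$ is $12$-represented by a word $w$ over $[n]$ containing at least one copy of each letter of $[n]$ if for all $i<j$ in $[n]$: $i$ and $j$ are adjacent if and only if every occurrence of $j$ precedes every occurrence of $i$ in $w$. For a pattern $p$, an (unlabeled) graph on $n$ vertices is $p$-representable if its vertices can be labeled bijectively by $[n]$ so that the resulting labeled graph is $12$-represented by some $p$-avoiding word. *)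

(* Defs.v *)
From mathcomp Require Import all_boot.

Set Implicit Arguments.
Unset Strict Implicit.
Unset Printing Implicit Defensive.

Definition word := seq nat.

(* A letter x of w is the i-th smallest letter of w, where i is the number of
   distinct letters of w that are at most x. *)
Definition red (w : word) : word :=
  [seq size (undup [seq y <- w | y <= x]) | x <- w].

Definition contains (p w : word) : Prop :=
  exists2 s : word, subseq s w & red s = p.

Definition avoids (p w : word) : Prop := ~ contains p w.

Record sgraph (T : finType) := SGraph {
  adj :> rel T;
  adj_sym : symmetric adj;
  adj_irrefl : irreflexive adj
}.

(* A labeled graph with vertex set [n] = {1, ..., n} is an sgraph 'I_n, the
   vertex i : 'I_n carrying the label i.+1. *)
Definition label (n : nat) (i : 'I_n) : nat := i.+1.

Definition covering_word (n : nat) (w : word) : Prop :=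
  forall a : nat, (a \in w) = (1 <= a <= n).

Definition all_precede (w : word) (b a : nat) : Prop :=
  forall k l : nat, k < size w -> l < size w ->
    nth 0 w k = b -> nth 0 w l = a -> k < l.

Definition represents12 (n : nat) (w : word) (G : sgraph 'I_n) : Prop :=
  covering_word n w /\
  forall i j : 'I_n, label i < label j ->
    (G i j <-> all_precede w (label j) (label i)).

Definition representable (p : word) (T : finType) (G : sgraph T) : Prop :=
  exists (H : sgraph 'I_#|T|) (f : T -> 'I_#|T|),
    [/\ bijective f,
        forall x y : T, G x y = H (f x) (f y)
      & exists2 w : word, avoids p w & represents12 w H].

(* Main.v *)
Require Import Defs.
From mathcomp Require Import all_boot.

(** All five equivalences come from one symmetry, the reverse-complement
    [rc n w]: read [w] backwards and replace each letter [x] by [n.+1 - x].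
    Complementing the labels swaps the smaller and the larger of two letters and
    reversal swaps before and after, so if [w] 12-represents a graph then
    [rc n w] 12-represents the same graph with its vertices relabeled by
    [i |-> n.+1 - i] ([all_precede_rc], [represents12_rc]).  The labels are
    irrelevant to representability of the unlabeled graph.

    Reduction commutes with the symmetry, provided that the reduced word, which
    has [m] distinct letters, is complemented in [1..m] ([red_rc]).  Hence a copy
    of [p] in [rc n w] is, read back in [w], a copy of the reverse-complement
    [rcp p] of [p], and representability for [rcp p] implies representability
    for [p] ([representable_rcp]).  Each of the five pairs consists of two
    patterns exchanged by [rcp], which gives both directions. *)

Set Implicit Arguments.
Unset Strict Implicit.
Unset Printing Implicit Defensive.

Definition rc (n : nat) (w : word) : word := rev [seq n.+1 - x | x <- w].

Definition rcp (p : word) : word := rc (size (undup p)) p.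

Lemma size_rc n w : size (rc n w) = size w.
Proof. by rewrite size_rev size_map. Qed.

Lemma nth_rc n w k : k < size w ->
  nth 0 (rc n w) k = n.+1 - nth 0 w (size w - k.+1).
Proof.
move=> lt_k; rewrite nth_rev size_map // (nth_map 0) //.
by rewrite ltn_subrL (leq_ltn_trans _ lt_k).
Qed.

Lemma rcK n w : {in w, forall x, x <= n} -> rc n (rc n w) = w.
Proof.
move=> le_w; rewrite /rc map_rev revK -map_comp map_id_in // => x /le_w le_x /=.
by rewrite subKn // leqW.
Qed.

Lemma subseq_rc n s w : subseq s w -> subseq (rc n s) (rc n w).
Proof. by move=> sub_sw; rewrite /rc subseq_rev map_subseq. Qed.

Lemma mem_rc n w a : {in w, forall x, 1 <= x <= n} ->
  (a \in rc n w) = (1 <= a <= n) && (n.+1 - a \in w).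
Proof.
move=> w_n; rewrite mem_rev; apply/mapP/andP => [[x x_w ->]|[/andP[a1 an] a_w]].
  have /andP[x1 xn] := w_n x x_w.
  by rewrite subKn ?leqW // subn_gt0 ltnS xn leq_subLR -add1n leq_add2r.
by exists (n.+1 - a); rewrite // subKn // leqW.
Qed.

Lemma covering_rc n w : covering_word n w -> covering_word n (rc n w).
Proof.
move=> cov_w a; rewrite mem_rc => [|x]; last by rewrite cov_w.
rewrite cov_w; have [/andP[a1 an]|//] := boolP (1 <= a <= n).
by rewrite subn_gt0 ltnS an leq_subLR -add1n leq_add2r.
Qed.

(** Reduction relabels the letters injectively: if [x < y], the letters up to [y]
    include all those up to [x], and also [y] itself.  So a pattern determines the
    number of distinct letters of each of its copies, and [rcp] may complement
    with that number. *)
Lemma size_undup_red s : size (undup (red s)) = size (undup s).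
Proof.
pose f x := size (undup [seq y <- s | y <= x]).
have f_lt x y : y \in s -> x < y -> f x < f y.
  move=> y_s lt_xy; apply: (@uniq_leq_size _ (y :: undup [seq z <- s | z <= x])).
    by rewrite /= undup_uniq mem_undup mem_filter leqNgt lt_xy.
  move=> z; rewrite inE !mem_undup !mem_filter.
  by case/orP=> [/eqP->|/andP[/leq_trans le_zx ->]]; rewrite ?leqnn ?le_zx // ltnW.
have f_inj : {in s &, injective f}.
  move=> x y x_s y_s eq_f; case: (ltngtP x y) => // [/(f_lt x y y_s)|].
    by rewrite eq_f ltnn.
  by move/(f_lt y x x_s); rewrite eq_f ltnn.
rewrite -(size_map f (undup s)); apply/perm_size/uniq_perm; rewrite ?undup_uniq //.
  by rewrite map_inj_in_uniq ?undup_uniq // => x y; rewrite !mem_undup; apply: f_inj.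
by move=> a; rewrite mem_undup; apply: eq_mem_map => x; rewrite mem_undup.
Qed.

(** The rank of [n.+1 - x] in [rc n s] is the number of letters [y >= x] of [s].
    Counting the letters [y >= x] and the letters [y <= x] together counts every
    letter once and [x] twice, so the two ranks add up to the number of distinct
    letters plus one. *)
Lemma red_rc n s : {in s, forall x, x <= n} ->
  red (rc n s) = rc (size (undup s)) (red s).
Proof.
move=> s_n; rewrite /red {2}/rc map_rev; congr (rev _); rewrite -!map_comp.
apply/eq_in_map => x x_s /=.
have ->: size (undup [seq y <- rc n s | y <= n.+1 - x])
         = count (fun y => x <= y) (undup s).
  rewrite -size_filter -(size_map (fun y => n.+1 - y)); apply/perm_size/uniq_perm.
  - exact: undup_uniq.
  - rewrite map_inj_in_uniq ?filter_uniq ?undup_uniq // => y z.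
    rewrite !mem_filter !mem_undup => /andP[_ y_s] /andP[_ z_s] eq_yz.
    by rewrite -(subKn (leqW (s_n y y_s))) eq_yz subKn // leqW ?s_n.
  move=> a; rewrite mem_undup mem_filter mem_rev.
  apply/andP/mapP => [[le_a /mapP[y y_s def_a]]|[y y_s ->]].
    exists y; rewrite // mem_filter mem_undup y_s andbT.
    by move: le_a; rewrite def_a leq_sub2lE // leqW ?s_n.
  move: y_s; rewrite mem_filter mem_undup => /andP[le_xy y_s].
  by rewrite leq_sub2l //; split=> //; apply: map_f.
rewrite -filter_undup size_filter -[LHS](addnK (count (fun y => y <= x) (undup s))).
rewrite -count_predUI; congr (_ - _).
rewrite (eq_count (a2 := predT)) => [|y]; last by rewrite /= leq_total.
rewrite count_predT (eq_count (a2 := pred1 x)) => [|y]; last first.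
  by rewrite /= eq_sym eqn_leq.
by rewrite count_uniq_mem ?undup_uniq // mem_undup x_s addn1.
Qed.

(** The hypothesis bears on [rcp p] rather than on [p], so that [p] is arbitrary:
    [rcp] is not an involution on words that are not reduced. *)
Lemma avoids_rc n p w : {in w, forall x, 1 <= x <= n} ->
  avoids (rcp p) w -> avoids p (rc n w).
Proof.
move=> w_n avoid_w [s sub_s red_s]; apply: avoid_w; exists (rc n s).
  rewrite -(@rcK n w) ?subseq_rc // => x /w_n/andP[] //.
rewrite red_rc => [|x /(mem_subseq sub_s)]; first by rewrite -size_undup_red red_s.
by rewrite mem_rc // => /andP[/andP[]].
Qed.

(** One implication is enough: by [rcK], applying it to [rc n w] gives the
    converse. *)
Lemma all_precede_rc n w a b : {in w, forall x, x <= n} -> a <= n -> b <= n ->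
  all_precede w b a -> all_precede (rc n w) (n.+1 - a) (n.+1 - b).
Proof.
move=> w_n an bn prec_w k l; rewrite size_rc => lt_k lt_l.
have inv i c : i < size w -> c <= n -> nth 0 (rc n w) i = n.+1 - c ->
    nth 0 w (size w - i.+1) = c.
  move=> lt_i cn; rewrite nth_rc // => /(congr1 (subn n.+1)).
  rewrite !subKn ?leqW //; apply: w_n; rewrite mem_nth //.
  by rewrite ltn_subrL (leq_ltn_trans _ lt_i).
move=> /inv-/(_ lt_k an) nth_k /inv-/(_ lt_l bn) nth_l.
have: size w - l.+1 < size w - k.+1.
  by apply: prec_w; rewrite // ltn_subrL (leq_ltn_trans _ lt_k).
by rewrite ltn_sub2lE.
Qed.

Definition rev_sgraph n (G : sgraph 'I_n) : sgraph 'I_n.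
Proof.
exists (fun i j => G (rev_ord i) (rev_ord j)).
  by move=> i j; apply: adj_sym.
by move=> i; apply: adj_irrefl.
Defined.

Lemma label_rev_ord n (i : 'I_n) : label (rev_ord i) = n.+1 - label i.
Proof. by rewrite /label /= subSS subnSK. Qed.

Lemma represents12_rc n w (G : sgraph 'I_n) :
  represents12 w G -> represents12 (rc n w) (rev_sgraph G).
Proof.
move=> [cov_w rep_w]; split=> [|i j lt_ij]; first exact: covering_rc.
have w_n v : covering_word n v -> {in v, forall x, x <= n}.
  by move=> cov_v x; rewrite cov_v => /andP[].
have lt_ji : label (rev_ord j) < label (rev_ord i).
  by rewrite !label_rev_ord ltn_sub2lE // leqW ?ltn_ord.
(* [rev_ord] exchanges the smaller and the larger of the two vertices. *)
rewrite [_ i j]adj_sym; apply: (iff_trans (rep_w _ _ lt_ji)); split=> prec.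
  rewrite -[i]rev_ordK -[j]rev_ordK !(label_rev_ord (rev_ord _)).
  by apply: all_precede_rc => //; [apply: w_n | apply: ltn_ord..].
rewrite !label_rev_ord -[w](@rcK n) //; last exact: w_n.
apply: all_precede_rc => //; [|apply: ltn_ord..].
exact/w_n/covering_rc.
Qed.

Lemma representable_rcp p (T : finType) (G : sgraph T) :
  representable (rcp p) G -> representable p G.
Proof.
move=> [H [f [f_bij GH [w avoid_w rep_w]]]].
exists (rev_sgraph H), (@rev_ord _ \o f); split.
- by apply: bij_comp => //; apply: inv_bij (@rev_ordK _).
- by move=> x y; rewrite GH /= !rev_ordK.
exists (rc #|T| w); last exact: represents12_rc.
by apply: avoids_rc avoid_w => x; rewrite (proj1 rep_w).
Qed.

Theorem corollary13 (p p' : word)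
    (hp : (p, p') \in [:: ([:: 1; 1; 2], [:: 1; 2; 2]);
                          ([:: 1; 2; 1], [:: 2; 1; 2]);
                          ([:: 2; 1; 1], [:: 2; 2; 1]);
                          ([:: 1; 3; 2], [:: 2; 1; 3]);
                          ([:: 2; 3; 1], [:: 3; 1; 2])])
    (T : finType) (G : sgraph T) :
  representable p G <-> representable p' G.
Proof.
have [def_p def_p']: p = rcp p' /\ p' = rcp p.
  by move: hp; rewrite !inE => /or4P[|||/orP[|]] /eqP[-> ->].
by split=> rep_G; apply: representable_rcp; rewrite -?def_p -?def_p'.
Qed.
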